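(* Axiom (A4) is independent of the other axioms, that is, in every Banach space $E$ there exists a set function $\nu\colon \mathcal B_E\to[0,+\infty)$ which satisfies axioms (A1), (A2), (A3) and (A5), but does not satisfy axiom (A4).
   Context: $E$ is a real or complex Banach space; $\mathcal B_E$ denotes the family of all non-empty bounded subsets of $E$, and $\mathcal K_E\subseteq\mathcal B_E$ the subfamily of relatively compact sets. $\operatorname{conv}A$ is the (not necessarily closed) convex hull; $A+B=\{a+b: a\in A, b\in B\}$, $\lambda A=\{\lambda a: a\in A\}$. For $\nu\colon\mathcal B_E\to[0,+\infty)$ put $\ker\nu=\{A\in\mathcal B_E:\nu(A)=0\}$. The axioms are: (A1) $\ker\nu$ is non-empty and $\ker\nu\subseteq\mathcal K_E$; (A2) for all $A,B\in\mathcal B_E$, if $A\subseteq B$ then $\nu(A)\le\nu(B)$; (A3) $\nu(\operatorname{conv}A)=\nu(A)$ for all $A\in\mathcal B_E$; (A4) $\nu(\lambda A+(1-\lambda)B)\le\lambda\nu(A)+(1-\lambda)\nu(B)$ for all $A,B\in\mathcal B_E$ and all $\lambda\in[0,1]$; (A5) if $A_n\in\mathcal B_E$ ($n\in\mathbb N$) are closed, $A_{n+1}\subseteq A_n$ for all $n$, and $\nu(A_n)\to0$, then $\bigcap_{n=1}^\infty A_n\ne\emptyset$.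
   Formalization: The formal theorem assumes that the Banach space E is not the zero space; for E = {0} the claim is false, since (A1) forces ν({0}) = 0 and then (A4) holds. *)

(* Defs.v *)
From HB Require Import structures.
From mathcomp Require Import all_boot all_order all_algebra.
From mathcomp Require Import all_classical all_reals all_analysis.
From mathcomp Require Export complex.
Import Order.TTheory GRing.Theory Num.Theory.
Import numFieldNormedType.Exports.

Set Implicit Arguments.
Unset Strict Implicit.
Unset Printing Implicit Defensive.

Local Open Scope classical_set_scope.
Local Open Scope ring_scope.

Definition conv_hull (K : numFieldType) (E : normedModType K) (A : set E) :
  set E := smallest (@convex_set K E) A.

Definition set_add (K : numFieldType) (E : normedModType K) (A B : set E) :
  set E := [set a + b | a in A & b in B].

Definition set_scale (K : numFieldType) (E : normedModType K) (k : K)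
  (A : set E) : set E := [set k *: a | a in A].

Definition bounded_family (K : numFieldType) (E : normedModType K) :
  set (set E) := [set A | A !=set0 /\ bounded_set A].

Definition relcompact_family (K : numFieldType) (E : normedModType K) :
  set (set E) := [set A | bounded_family A /\ precompact A].

(* A set function nu on the bounded family is represented by a total function
   set E -> R; everything below only looks at its values on bounded_family.
   The scalar field K of E is R itself or R[i]; emb : R -> K is the inclusion
   of the reals, used to let real coefficients act on E. *)
Section SetFunctions.
Context (R : realType) (K : numFieldType) (emb : R -> K)
  (E : normedModType K).
Implicit Types (nu : set E -> R) (A B : set E).

Definition nonneg_on_bounded nu :=
  forall A, bounded_family A -> 0 <= nu A.

Definition ker nu : set (set E) := [set A | bounded_family A /\ nu A = 0].

Definition axiomA1 nu := ker nu !=set0 /\ ker nu `<=` @relcompact_family K E.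

Definition axiomA2 nu := forall A B, bounded_family A -> bounded_family B ->
  A `<=` B -> nu A <= nu B.

Definition axiomA3 nu := forall A, bounded_family A ->
  nu (conv_hull A) = nu A.

Definition axiomA4 nu := forall A B (l : R),
  bounded_family A -> bounded_family B -> 0 <= l <= 1 ->
  nu (set_add (set_scale (emb l) A) (set_scale (emb (1 - l)) B))
    <= l * nu A + (1 - l) * nu B.

Definition axiomA5 nu := forall A : nat -> set E,
  (forall n, bounded_family (A n)) -> (forall n, closed (A n)) ->
  (forall n, A n.+1 `<=` A n) -> nu (A n) @[n --> \oo] --> (0 : R) ->
  \bigcap_n A n !=set0.

End SetFunctions.

(* Main.v *)
Require Import Defs.
From HB Require Import structures.
From mathcomp Require Import all_boot all_order all_algebra.
From mathcomp Require Import all_classical all_reals all_analysis.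
Import Order.TTheory GRing.Theory Num.Theory.
Import numFieldNormedType.Exports.

Set Implicit Arguments.
Unset Strict Implicit.
Unset Printing Implicit Defensive.

Local Open Scope classical_set_scope.
Local Open Scope ring_scope.
Local Open Scope complex_scope.

(** The witness is the set function that vanishes on one-point sets and equals
    1 on all other nonempty sets.  It is monotone, its kernel consists of
    compact sets, and it is invariant under convex hulls because one-point sets
    are convex ([is_subset1_conv_hull]).  As it takes only the values 0 and 1,
    a decreasing sequence along which it tends to 0 is eventually a constant
    one-point set, whence the Cantor property ([axiomA5_nontrivial]).
    Convexity fails because the function does not see the size of a set:
    half of {0, x} still has two points, so the left-hand side of (A4) for
    {0, x}, {0} and the coefficient 1/2 is 1, but the right-hand side is 1/2
    ([not_axiomA4_nontrivial]). *)

(** [is_subset1] means at most one point, so the property is inherited by all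
    subsets; on nonempty sets, the only ones that the axioms see, it singles
    out the one-point sets. *)
Definition nontrivial (R : realType) (T : Type) (A : set T) : R :=
  (~~ `[< is_subset1 A >])%:R.

Lemma nontrivial_eq0 (R : realType) (T : Type) (A : set T) :
  nontrivial R A = 0 <-> is_subset1 A.
Proof.
rewrite /nontrivial; split=> [/eqP|A1]; last by rewrite (asboolT A1).
by rewrite pnatr_eq0 eqb0 negbK => /asboolP.
Qed.

Lemma bounded_family2 (K : numFieldType) (E : normedModType K) (x y : E) :
  bounded_family [set x; y].
Proof.
split; first by exists x; left.
rewrite /= /bounded_near.
have xyR : `|x| + `|y| \is Num.real by apply: realD; exact: normr_real.
near=> M.
have leM : `|x| + `|y| <= M by near: M; exact: nbhs_pinfty_ge.
by move=> z [->|->] /=; apply: le_trans leM; rewrite ?lerDl ?lerDr normr_ge0.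
Unshelve. all: by end_near. Qed.

Lemma bounded_family1 (K : numFieldType) (E : normedModType K) (x : E) :
  bounded_family [set x].
Proof. by rewrite -[X in bounded_family X]setUid; exact: bounded_family2. Qed.

Lemma convex_set1 (K : numFieldType) (E : normedModType K) (x : E) :
  @convex_set K E [set x].
Proof. by move=> y z l; rewrite !inE => -> ->; rewrite convmm. Qed.

Lemma subset1_set1 (T : Type) (A : set T) (a : T) :
  A a -> is_subset1 A -> A = [set a].
Proof.
by move=> Aa A1; apply/seteqP; split=> [x Ax|x ->//]; exact: A1.
Qed.

(** One-point sets are convex, so the hull of {a} is {a}; conversely a set lies
    inside its hull. *)
Lemma is_subset1_conv_hull (K : numFieldType) (E : normedModType K)
    (A : set E) :
  A !=set0 -> is_subset1 (conv_hull A) <-> is_subset1 A.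
Proof.
move=> [a Aa]; split=> [cA1 x y Ax Ay|A1 x y].
  by apply: cA1; exact: sub_gen_smallest.
have sub : conv_hull A `<=` [set a].
  apply: smallest_sub; first exact: convex_set1.
  by rewrite (subset1_set1 Aa A1).
by move=> /sub -> /sub ->.
Qed.

Lemma axiomA1_nontrivial (R : realType) (K : numFieldType)
    (E : normedModType K) : axiomA1 (@nontrivial R E).
Proof.
split.
  exists [set 0]; split; first exact: bounded_family1.
  by apply/nontrivial_eq0 => x y -> ->.
move=> A [bA /nontrivial_eq0 A1]; split=> //.
case: (bA) => -[a Aa] _.
rewrite (subset1_set1 Aa A1); apply: compact_precompact.
  exact: norm_hausdorff.
exact: compact_set1.
Qed.

Lemma axiomA2_nontrivial (R : realType) (K : numFieldType)
    (E : normedModType K) : axiomA2 (@nontrivial R E).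
Proof.
move=> A B _ _ AB; rewrite ler_nat.
case: asboolP => //= nA; case: asboolP => //= B1.
by case: nA => x y /AB Bx /AB By; exact: B1.
Qed.

Lemma axiomA3_nontrivial (R : realType) (K : numFieldType)
    (E : normedModType K) : axiomA3 (@nontrivial R E).
Proof.
move=> A [A0 _]; rewrite /nontrivial.
by rewrite (asbool_equiv_eq (is_subset1_conv_hull A0)).
Qed.

(** A 0-1 valued sequence tending to 0 vanishes from some index N on, so all
    sets after the N-th are the same point, which then lies in every set. *)
Lemma axiomA5_nontrivial (R : realType) (K : numFieldType)
    (E : normedModType K) : axiomA5 (@nontrivial R E).
Proof.
move=> A bA _ decA /cvgrPdist_lt /(_ 1 ltr01)[N _ /(_ N (leqnn N))].
rewrite sub0r normrN ger0_norm ?ler0n// ltrn1 ltnS leqn0 eqb0 negbK.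
move=> /asboolP AN1.
have monA : {homo A : m n / (m <= n)%N >-> n `<=` m}.
  by apply: homo_leq => // [B|B C D CB DC]; [|apply: subset_trans CB].
have [[a Aa] _] := bA N; exists a => n _.
have [[b Ab] _] := bA (maxn n N).
rewrite (AN1 a b Aa (monA _ _ (leq_maxr n N) _ Ab)).
exact: monA (leq_maxl n N) _ Ab.
Qed.

(** The sets {0, x} and {0} with coefficient 1/2 violate (A4): the combination
    contains the two points 0 and x/2, so the inequality would read
    1 <= 1/2. *)
Lemma not_axiomA4_nontrivial (R : realType) (K : numFieldType) (emb : R -> K)
    (E : normedModType K) :
  emb 2^-1 != 0 -> (exists x : E, x != 0) -> ~ axiomA4 emb (@nontrivial R E).
Proof.
move=> e0 [x x0] /(_ [set 0; x] [set 0] 2^-1 (bounded_family2 _ _)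
  (bounded_family1 _)).
have -> : nontrivial R [set (0 : E)] = 0.
  by apply/nontrivial_eq0 => y z -> ->.
rewrite mulr0 addr0 /nontrivial.
case: asboolP => [S1 _|_ /(_ _)/=].
  have /eqP : emb 2^-1 *: x = 0.
    apply: S1.
      exists (emb 2^-1 *: x); first by exists x => //; right.
      by exists 0; [exists 0; rewrite ?scaler0|rewrite addr0].
    exists 0; first by exists 0; [left|rewrite scaler0].
    by exists 0; [exists 0; rewrite ?scaler0|rewrite addr0].
  by rewrite scaler_eq0 (negPf e0) (negPf x0).
have h0 : 0 <= 2^-1 :> R by rewrite invr_ge0.
have h1 : (2^-1 < 1 :> R) by rewrite invf_lt1 ?ltr1n.
rewrite h0 (ltW h1) => /(_ isT).
apply/negP; rewrite -ltNge; apply: le_lt_trans h1.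
by rewrite ler_piMr // lern1 leq_b1.
Qed.

(** Asking of [emb] only that the image of 1/2 be nonzero lets one statement
    cover real and complex scalars. *)
Lemma A4_independent (R : realType) (K : numFieldType) (emb : R -> K)
    (E : normedModType K) :
  emb 2^-1 != 0 -> (exists x : E, x != 0) ->
  exists nu : set E -> R,
    [/\ nonneg_on_bounded nu, axiomA1 nu, axiomA2 nu, axiomA3 nu
      & axiomA5 nu] /\ ~ axiomA4 emb nu.
Proof.
move=> e0 Ex; exists (@nontrivial R E); split; last first.
  exact: not_axiomA4_nontrivial.
split; first by move=> A _; exact: ler0n.
- exact: axiomA1_nontrivial.
- exact: axiomA2_nontrivial.
- exact: axiomA3_nontrivial.
- exact: axiomA5_nontrivial.
Qed.

Theorem mainTheorem3 (R : realType) :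
  (forall E : completeNormedModType R, (exists x : E, x != 0) ->
    exists nu : set E -> R,
      [/\ nonneg_on_bounded nu, axiomA1 nu, axiomA2 nu, axiomA3 nu
        & axiomA5 nu] /\ ~ axiomA4 (fun r : R => r) nu) /\
  (forall E : completeNormedModType R[i], (exists x : E, x != 0) ->
    exists nu : set E -> R,
      [/\ nonneg_on_bounded nu, axiomA1 nu, axiomA2 nu, axiomA3 nu
        & axiomA5 nu] /\ ~ axiomA4 (real_complex R) nu).
Proof.
split=> E; apply: A4_independent.
  by rewrite invr_eq0 pnatr_eq0.
by rewrite fmorph_eq0 invr_eq0 pnatr_eq0.
Qed.
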